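(* Let $V$ be a finite vocabulary, let $\rho:V\times V\to[0,1]$ be a rating function with sensitivity $\Delta>0$ (all words being considered adjacent), let $\epsilon>0$ be a privacy parameter, and let $n\in\mathbb{N}$, $n\ge 1$, be an output length. Then the SynTF mechanism with parameters $V,\rho,\epsilon,n$ fulfills $\epsilon n$-differential privacy, where any two input documents are considered adjacent.
   Context: **Randomized mechanism.** A randomized mechanism $\mathcal{M}$ from $\mathcal{X}$ to $\mathcal{Z}$ assigns to each input $x\in\mathcal{X}$ a random variable $\mathcal{M}(x)$ with values in $\mathcal{Z}$. **Differential privacy.** Given a symmetric adjacency relation on $\mathcal{X}$, the mechanism $\mathcal{M}$ fulfills $\epsilon$-differential privacy if $\Pr[\mathcal{M}(x_1)\in Z]\le e^{\epsilon}\Pr[\mathcal{M}(x_2)\in Z]$ for all adjacent $x_1,x_2\in\mathcal{X}$ and every set $Z$ of possible outputs. **Sensitivity.** Since all words of $V$ are considered adjacent, the sensitivity of $\rho$ is $\Delta=\max_{w\in V}\max_{v_1,v_2\in V}\big(\rho(v_1,w)-\rho(v_2,w)\big)$. **Exponential mechanism on $V$.** For $v\in V$, $\mathcal{E}_{\epsilon,\rho}(v)$ is the $V$-valued random variable with $$\Pr[\mathcal{E}_{\epsilon,\rho}(v)=w]=\frac{\exp\left(\frac{\epsilon}{2\Delta}\rho(v,w)\right)}{\sum_{w'\in V}\exp\left(\frac{\epsilon}{2\Delta}\rho(v,w')\right)}.$$ **SynTF mechanism.** The input is a document given by its composition vector $\theta=(\theta_v)_{v\in V}$, a probability vector on $V$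 (obtained as $\theta=\mathbf{t}/\|\mathbf{t}\|_1$ from a nonzero vector $\mathbf{t}\in\mathbb{R}_{\ge0}^{V}$ of term frequencies or tf-idf values). For $i=1,\dots,n$, independently: sample $v_i\in V$ with $\Pr[v_i=v]=\theta_v$, then sample $w_i$ from $\mathcal{E}_{\epsilon,\rho}(v_i)$. The output is the count vector $\mathbf{s}=\big(|\{i\in\{1,\dots,n\}:w_i=w\}|\big)_{w\in V}\in\mathbb{N}_{\geq 0}^{V}$. The length $n$ is a fixed parameter, the same for all inputs. Any two inputs are considered adjacent. *)

(* Defs.v *)
From HB Require Import structures.
From mathcomp Require Import all_boot all_order all_algebra.
From mathcomp Require Import all_classical all_reals all_analysis.

Set Implicit Arguments.
Unset Strict Implicit.
Unset Printing Implicit Defensive.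

Import Order.TTheory GRing.Theory Num.Theory.

Local Open Scope classical_set_scope.
Local Open Scope ring_scope.

(* A mechanism assigns to each input a random variable; only the distribution
   of that variable matters, so M x is a probability measure on the outputs:
   M x S is the probability that the output on input x lies in S. *)
Definition mechanism (R : realType) (X : Type) d (Z : measurableType d) :=
  X -> probability Z R.

Definition differentially_private (R : realType) (X : Type) d
    (Z : measurableType d) (adj : X -> X -> Prop) (M : mechanism R X Z)
    (eps : R) : Prop :=
  forall x1 x2, adj x1 x2 -> forall S : set Z, measurable S ->
    (M x1 S <= (expR eps)%:E * M x2 S)%E.

Record fdist (R : realType) (T : finType) := FDist {
  fdist_pmf :> T -> R ;
  fdist_ge0 : forall x, 0 <= fdist_pmf x ;
  fdist_sum1 : \sum_x fdist_pmf x = 1 }.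

Section fdist_dpair.
Variables (R : realType) (T U : finType) (p : fdist R T) (q : T -> fdist R U).

Definition dpair_pmf (z : T * U) : R := p z.1 * q z.1 z.2.

Lemma dpair_pmf_ge0 z : 0 <= dpair_pmf z.
Proof. by rewrite mulr_ge0// fdist_ge0. Qed.

Lemma dpair_pmf_sum1 : \sum_z dpair_pmf z = 1.
Proof.
rewrite -(pair_bigA _ (fun x y => p x * q x y)) /= -(fdist_sum1 p).
by apply: eq_bigr => x _; rewrite -mulr_sumr fdist_sum1 mulr1.
Qed.

(* Sample x from p, then y from q x, and return (x, y). *)
Definition fdist_dpair : fdist R (T * U)%type :=
  FDist dpair_pmf_ge0 dpair_pmf_sum1.

End fdist_dpair.

Section fdist_iid.
Variables (R : realType) (T : finType) (p : fdist R T) (n : nat).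

Definition iid_pmf (f : {ffun 'I_n -> T}) : R := \prod_(i < n) p (f i).

Lemma iid_pmf_ge0 f : 0 <= iid_pmf f.
Proof. by apply: prodr_ge0 => i _; exact: fdist_ge0. Qed.

Lemma iid_pmf_sum1 : \sum_f iid_pmf f = 1.
Proof.
rewrite /iid_pmf -(bigA_distr_bigA (fun=> p)) /=.
by rewrite big1// => i _; exact: fdist_sum1.
Qed.

(* n independent samples from p. *)
Definition fdist_iid : fdist R {ffun 'I_n -> T} :=
  FDist iid_pmf_ge0 iid_pmf_sum1.

End fdist_iid.

Section law.
Variables (R : realType) (T : finType) (d : measure_display).
Variables (Z : measurableType d) (p : fdist R T) (Y : T -> Z).
Local Open Scope ereal_scope.

(* The distribution of the random variable Y on the finite probability space
   (T, p). *)
Definition law (S : set Z) : \bar R := \sum_(t : T) (p t)%:E * \d_(Y t) S.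

Let law0 : law set0 = 0.
Proof. by apply: big1 => t _; rewrite measure0 mule0. Qed.

Let law_ge0 S : 0 <= law S.
Proof.
by apply: sume_ge0 => t _; rewrite mule_ge0// lee_fin; exact: fdist_ge0.
Qed.

Let law_sigma_additive : semi_sigma_additive law.
Proof.
pose m (t : T) : {measure set Z -> \bar R} :=
  mscale (NngNum (fdist_ge0 p t)) (\d_(Y t)).
have -> : law = msum (fun k => if insub k is Some i
    then m (enum_val (i : 'I_#|T|)) else mzero) #|T| :> (set Z -> \bar R).
  apply/funext => S; rewrite /law /msum (reindex (@enum_val T predT))/=.
    by apply: eq_bigr => i _; rewrite valK.
  by apply: onW_bij; exact: enum_val_bij.
exact: measure_semi_sigma_additive.
Qed.

HB.instance Definition _ := isMeasure.Build _ _ _ law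
  law0 law_ge0 law_sigma_additive.

Let law_setT : law setT = 1.
Proof.
rewrite /law (eq_bigr (fun t => (p t)%:E)); last first.
  by move=> t _; rewrite diracT mule1.
by rewrite sumEFin fdist_sum1.
Qed.

HB.instance Definition _ := Measure_isProbability.Build _ _ _ law law_setT.

End law.

Section exponential_mechanism.
Variables (R : realType) (V : finType).

(* The seed 0 changes nothing, as the terms with v1 = v2 are 0. *)
Definition sensitivity (rho : V -> V -> R) : R :=
  \big[Num.max/0]_(w : V) \big[Num.max/0]_(v1 : V) \big[Num.max/0]_(v2 : V)
    (rho v1 w - rho v2 w).

Variables (eps : R) (rho : V -> V -> R) (v : V).

Definition exp_weight (w : V) : R :=
  expR (eps / (2 * sensitivity rho) * rho v w).

Definition exp_pmf (w : V) : R := exp_weight w / \sum_(w' : V) exp_weight w'.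

Lemma exp_pmf_ge0 w : 0 <= exp_pmf w.
Proof.
by rewrite divr_ge0 ?expR_ge0// sumr_ge0// => w' _; exact: expR_ge0.
Qed.

Lemma exp_pmf_sum1 : \sum_w exp_pmf w = 1.
Proof.
rewrite -mulr_suml divff// gt_eqF// (bigD1 v)//= ltr_pwDl ?expR_gt0//.
by apply: sumr_ge0 => w' _; exact: expR_ge0.
Qed.

(* The distribution of the random word that the mechanism returns on v. *)
Definition exponential_mechanism : fdist R V := FDist exp_pmf_ge0 exp_pmf_sum1.

End exponential_mechanism.

Definition count_vector (V : finType) := {ffun V -> nat}.

HB.instance Definition _ (V : finType) := Choice.on (count_vector V).
HB.instance Definition _ (V : finType) :=
  isPointed.Build (count_vector V) [ffun=> 0%N].
(* Every set of outputs is measurable. *)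
HB.instance Definition _ (V : finType) :=
  @isMeasurable.Build default_measure_display (count_vector V)
    discrete_measurable discrete_measurable0
    discrete_measurableC discrete_measurableU.

Definition counts (V : finType) (n : nat) (w : {ffun 'I_n -> V}) :
  count_vector V := [ffun u => #|[set i | w i == u]%SET|].

(* A document is given by its composition vector; the vectors obtained by
   normalizing a nonzero nonnegative vector are exactly the probability
   vectors. *)
Definition document (R : realType) (V : finType) := fdist R V.

(* The sample space carries n independent pairs (v_i, w_i), with v_i drawn from
   theta and w_i from the exponential mechanism on v_i. *)
Definition SynTF (R : realType) (V : finType) (rho : V -> V -> R) (eps : R)
    (n : nat) : mechanism R (document R V) (count_vector V) :=
  fun theta =>
    law (fdist_iid (fdist_dpair theta (exponential_mechanism eps rho)) n)
        (fun vw => counts [ffun i => (vw i).2]).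

(* Main.v *)
(* For every word w the exponential mechanism satisfies
   E(v1)(w) <= e^eps E(v2)(w), half of the exponent coming from the numerators
   and half from the normalizing sums. This bound survives averaging v1 over one
   document and v2 over another, so the laws of a single w_i differ by a factor
   at most e^eps, the laws of (w_1, ..., w_n) by a factor at most e^(eps n), and
   the count vector is a function of (w_1, ..., w_n). *)
Require Import Defs.
From HB Require Import structures.
From mathcomp Require Import all_boot all_order all_algebra.
From mathcomp Require Import all_classical all_reals all_analysis.
From mathcomp Require Import ring.

Set Implicit Arguments.
Unset Strict Implicit.
Unset Printing Implicit Defensive.

Import Order.TTheory GRing.Theory Num.Theory.

Local Open Scope ring_scope.

Lemma le_sensitivity (R : realType) (V : finType) (rho : V -> V -> R) v1 v2 w :
  rho v1 w - rho v2 w <= sensitivity rho.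
Proof.
by do 3! apply: le_trans (le_bigmax _ _ _).
Qed.

Section exponential_mechanism_dp.
Variables (R : realType) (V : finType) (rho : V -> V -> R) (eps : R).
Hypotheses (Delta0 : 0 < sensitivity rho) (eps0 : 0 <= eps).

Lemma exp_weight_le v1 v2 w :
  exp_weight eps rho v1 w <= expR (eps / 2) * exp_weight eps rho v2 w.
Proof.
rewrite /exp_weight -expRD ler_expR -lerBlDr -mulrBr.
(* The factor 2 in the exponent leaves exactly [eps / 2] once the rating gap is bounded by the
   sensitivity. *)
have -> : eps / 2 = eps / (2 * sensitivity rho) * sensitivity rho.
  by field; rewrite gt_eqF.
apply: ler_wpM2l; last exact: le_sensitivity.
by rewrite divr_ge0// mulr_ge0// ltW.
Qed.

Lemma exponential_mechanism_le v1 v2 w :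
  exponential_mechanism eps rho v1 w
    <= expR eps * exponential_mechanism eps rho v2 w.
Proof.
have sum_gt0 v : 0 < \sum_w' exp_weight eps rho v w'.
  rewrite (bigD1 v)//= ltr_pwDl ?expR_gt0//.
  by apply: sumr_ge0 => w' _; exact: expR_ge0.
(* The roles of [v1] and [v2] are swapped here because the normalizing sums are denominators. *)
have sum_le : \sum_w' exp_weight eps rho v2 w'
    <= expR (eps / 2) * \sum_w' exp_weight eps rho v1 w'.
  by rewrite mulr_sumr; apply: ler_sum => w' _; exact: exp_weight_le.
rewrite /= /exp_pmf mulrA ler_pdivrMr// mulrAC ler_pdivlMr//.
have -> : expR eps = expR (eps / 2) * expR (eps / 2).
  by rewrite -expRD -splitr.
apply: le_trans (ler_pM _ _ (exp_weight_le v1 v2 w) sum_le) _.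
- exact: expR_ge0.
- exact: ltW.
- by rewrite mulrACA mulrA.
Qed.

Lemma dpair_exponential_mechanism_le (p1 p2 : fdist R V) w :
  \sum_(z | z.2 == w) fdist_dpair p1 (exponential_mechanism eps rho) z
    <= expR eps *
       \sum_(z | z.2 == w) fdist_dpair p2 (exponential_mechanism eps rho) z.
Proof.
have marginal (p : fdist R V) :
    \sum_(z | z.2 == w) fdist_dpair p (exponential_mechanism eps rho) z
      = \sum_v p v * exponential_mechanism eps rho v w.
  rewrite -(pair_big xpredT (fun u => u == w)
    (fun v u => p v * exponential_mechanism eps rho v u)) /=.
  by apply: eq_bigr => v _; rewrite big_pred1_eq.
(* Inserting the total masses of [p1] and [p2] as factors 1 turns both sides into averages over the
   same pairs [(v1, v2)], which are compared term by term. *)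
rewrite !marginal -[leRHS]mul1r -(fdist_sum1 p1) mulr_suml.
apply: ler_sum => v1 _; apply: ler_wpM2l; first exact: fdist_ge0.
rewrite -[leLHS]mul1r -(fdist_sum1 p2) mulr_suml mulr_sumr.
apply: ler_sum => v2 _; rewrite [leRHS]mulrCA.
apply: ler_wpM2l; first exact: fdist_ge0.
exact: exponential_mechanism_le.
Qed.

End exponential_mechanism_dp.

(** The fibre over [w] is a product of one condition per coordinate, so the sum of products
    factors. *)
Lemma fdist_iid_map (R : realType) (T U : finType) (p : fdist R T) (h : T -> U)
    n (w : {ffun 'I_n -> U}) :
  \sum_(f : {ffun 'I_n -> T} | [ffun i => h (f i)] == w) fdist_iid p n f
    = \prod_i \sum_(t | h t == w i) p t.
Proof.
rewrite (bigA_distr_big_dep (fun i t => h t == w i) (fun=> p)) /=.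
apply: eq_bigl => f; apply/eqP/familyP => [<- i|hf].
  by rewrite unfold_in ffunE.
by apply/ffunP => i; rewrite ffunE; apply/eqP/hf.
Qed.

(** Grouping samples by their image under [h] leaves [p] only in the weights; with [h := snd] this
    sums out the hidden words v_i. *)
Lemma law_fdist_iid_map (R : realType) (T U : finType) (d : measure_display)
    (Z : measurableType d) (p : fdist R T) (h : T -> U) n
    (Y : {ffun 'I_n -> U} -> Z) (S : set Z) :
  law (fdist_iid p n) (fun f => Y [ffun i => h (f i)]) S
    = (\sum_(w : {ffun 'I_n -> U})
         (\prod_i \sum_(t | h t == w i) p t)%:E * \d_(Y w) S)%E.
Proof.
rewrite /law.
rewrite (partition_big (fun f : {ffun 'I_n -> T} => [ffun i => h (f i)]) xpredT)//=.
apply: eq_bigr => w _; rewrite -fdist_iid_map -sumEFin ge0_sume_distrl.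
  by apply: eq_bigr => f /eqP ->.
by move=> f _; rewrite lee_fin; exact: (fdist_ge0 (fdist_iid p n)).
Qed.

Theorem theorem3p3 (R : realType) (V : finType) (rho : V -> V -> R)
    (rho01 : forall v w, 0 <= rho v w <= 1) (Delta0 : 0 < sensitivity rho)
    (eps : R) (eps0 : 0 < eps) (n : nat) (n0 : (1 <= n)%N) :
  differentially_private (fun _ _ : document R V => True)
    (SynTF rho eps n) (eps * n%:R).
Proof.
move=> p1 p2 _ S _.
have SynTFE p : SynTF rho eps n p S = (\sum_(w : {ffun 'I_n -> V})
    (\prod_i \sum_(z | z.2 == w i)
      fdist_dpair p (exponential_mechanism eps rho) z)%:E *
    \d_(counts w) S)%E.
  exact: (law_fdist_iid_map _ snd (@counts V n)).
rewrite !SynTFE ge0_sume_distrr; last first.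
  move=> w _; rewrite mule_ge0// lee_fin prodr_ge0// => i _.
  by rewrite sumr_ge0// => z _; exact: fdist_ge0.
apply: lee_sum => w _; rewrite muleA.
apply: lee_wpmul2r; first exact: measure_ge0.
(* The factor e^(eps n) is spread as one e^eps per index, so that the products compare factor by
   factor. *)
rewrite -EFinM lee_fin expRM_natr -[X in _ ^+ X]card_ord -prodr_const -big_split/=.
apply: ler_prod => i _; apply/andP; split.
  by rewrite sumr_ge0// => z _; exact: dpair_pmf_ge0.
exact/dpair_exponential_mechanism_le/ltW.
Qed.
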